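(* Let $\tilde\Omega_Q:=\Omega_Q+\Omega_0$ be an affine almost symplectic structure for the nonholonomic system $(Q,\mathcal{L},\mathcal{D})$. The following statements are true: 1. $\tilde\Omega_Q$ is non-degenerate. 2. The point-wise restriction of $\tilde\Omega_Q$ to $\mathcal{C}$, denoted $\tilde\Omega_{\mathcal{C}}$, is non-degenerate. 3. The nonholonomic vector field $X_{\mathrm{nh}}^{\mathcal{M}}$ satisfies $\mathbf{i}_{X_{\mathrm{nh}}^{\mathcal{M}}}\iota^*\Omega_Q=\mathbf{i}_{X_{\mathrm{nh}}^{\mathcal{M}}}\iota^*\tilde\Omega_Q$. 4. The symplectic complement $\mathcal{F}^{\Omega_Q}$ of $\mathcal{F}$ with respect to $\Omega_Q$ equals the symplectic complement $\mathcal{F}^{\tilde\Omega_Q}$ of $\mathcal{F}$ with respect to $\tilde\Omega_Q$, that is, $\mathcal{F}^{\Omega_Q}=\mathcal{F}^{\tilde\Omega_Q}$.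
   Context: Setting: $Q$ is a smooth $n$-dimensional manifold, $\mathcal{L}:TQ\to\mathbb{R}$ is a hyper-regular Lagrangian whose Legendre transform $\mathrm{Leg}:TQ\to T^*Q$ is a global diffeomorphism, linear on fibers, and $\mathcal{D}\subset TQ$ is a non-integrable distribution, the common annihilator of independent one-forms $\epsilon^1,\dots,\epsilon^k$ on $Q$, $k<n$. $\Omega_Q$ is the canonical symplectic form on $T^*Q$ ($\Omega_Q=dq_a\wedge dp_a$), $\tau:T^*Q\to Q$ the projection, and $\mathcal{H}=E_{\mathcal{L}}\circ\mathrm{Leg}^{-1}$ the Hamiltonian, with $E_{\mathcal{L}}=\frac{\partial\mathcal{L}}{\partial\dot q_a}\dot q_a-\mathcal{L}$. Put $\mathcal{M}=\mathrm{Leg}(\mathcal{D})$ with inclusion $\iota:\mathcal{M}\hookrightarrow T^*Q$, $\mathcal{F}=\{v\in T(T^*Q):\langle\tau^*\epsilon^i,v\rangle=0\ \forall i\}$ (a distribution on $T^*Q$), $\mathcal{C}=T\mathcal{M}\cap\mathcal{F}$ (a distribution on $\mathcal{M}$). By a theorem of Bates and Śniatycki, taken as part of the setting, the point-wise restriction $\Omega_{\mathcal{C}}$ of $\Omega_Q$ to $\mathcal{C}$ is non-degenerate. The nonholonomic vector field $X_{\mathrm{nh}}^{\mathcal{M}}$ is the vector field on $\mathcal{M}$ with values in $\mathcal{C}$ satisfying $\mathbf{i}_{X_{\mathrm{nh}}^{\mathcal{M}}}\iota^*\Omega_Q=\iota^*(d\mathcal{H}+\lambda_i\tau^*\epsilon^i)$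 for some scalar functions $\lambda_i$; it is the vector field on $\mathcal{M}$ defined by the constrained equations $\dot q_a=\partial\mathcal{H}/\partial p_a$, $\dot p_a=-\partial\mathcal{H}/\partial q_a+\lambda_i\epsilon^i_a(q)$, where $\epsilon^i=\epsilon^i_a\,dq_a$. The free Hamiltonian vector field $X_{\mathcal{H}}$ on $T^*Q$ is defined by $\mathbf{i}_{X_{\mathcal{H}}}\Omega_Q=d\mathcal{H}$. Definition: a nontrivial two-form $\Omega_0$ on $T^*Q$ defines an affine almost symplectic structure $\tilde\Omega_Q=\Omega_Q+\Omega_0$ for the nonholonomic system if (1) $\mathbf{i}_{X_{\mathcal{H}}}\Omega_0=0$; and (2) $\Omega_0$ is semi-basic, i.e. $\mathbf{i}_v\Omega_0=0$ for every tangent vector $v$ to $T^*Q$ with $\tau_*v=0$. For a subbundle $W$ and a two-form $\omega$, $W^{\omega}=\{v:\omega(v,w)=0\ \forall w\in W\}$ pointwise. *)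

(* Defs.v *)
From HB Require Import structures.
From mathcomp Require Import all_boot all_order all_algebra.
From mathcomp Require Import all_classical all_reals all_analysis.

Set Implicit Arguments.
Unset Strict Implicit.
Unset Printing Implicit Defensive.

Import Order.TTheory GRing.Theory Num.Theory.
Import numFieldNormedType.Exports.

Local Open Scope classical_set_scope.
Local Open Scope ring_scope.

(* f is C^oo on the open set A: every iterated directional derivative of f is
   differentiable at every point of A. *)
Definition smooth_on {R : realType} {V W : normedModType R}
    (A : set V) (f : V -> W) : Prop :=
  forall (s : seq V) (x : V), A x ->
    differentiable (foldr (fun v (g : V -> W) => 'D_v g) f s) x.

(* A set X with charts valued in E.  [chart_param i] is the inverse of
   [chart_coord i]; it is total, but only meaningful on [chart_image ch i].
   [chart_at] selects a chart around each point, and the tangent space T_x X is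
   represented by E itself: a vector of E stands for the tangent vector whose
   components in the selected chart at x it lists. *)
Record charted {R : realType} (X : Type) (E : normedModType R) := Charted {
  chart_index : Type;
  chart_dom : chart_index -> set X;
  chart_coord : chart_index -> X -> E;
  chart_param : chart_index -> E -> X;
  chart_at : X -> chart_index }.

Section Calculus.
Context {R : realType} {X Y : Type} {E F : normedModType R}.
Variables (cX : charted X E) (cY : charted Y F).

Definition chart_image (i : chart_index cX) : set E :=
  chart_coord i @` chart_dom i.

Definition coord_at (x : X) : E := chart_coord (chart_at cX x) x.

(* From components in chart i, at the point of coordinates y, to the
   representative in the tangent space of that point; and back. *)
Definition vec_of_comp (i : chart_index cX) (y : E) : E -> E :=
  'd (chart_coord (chart_at cX (chart_param i y)) \o chart_param i) y.

Definition comp_of_vec (i : chart_index cX) (x : X) : E -> E :=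
  'd (chart_coord i \o chart_param (chart_at cX x)) (coord_at x).

(* Smoothness in charts; the openness clause is continuity of f. *)
Definition smooth_map (f : X -> Y) : Prop :=
  forall (i : chart_index cX) (j : chart_index cY),
    let A := chart_coord i @` (chart_dom i `&` f @^-1` chart_dom j) in
    open A /\ smooth_on A (chart_coord j \o f \o chart_param i).

Definition smooth_fun (f : X -> R) : Prop :=
  forall i : chart_index cX, smooth_on (chart_image i) (f \o chart_param i).

Definition tangent_map (f : X -> Y) (x : X) : E -> F :=
  'd (chart_coord (chart_at cY (f x)) \o f \o chart_param (chart_at cX x))
     (coord_at x).

Definition dfun (f : X -> R) (x : X) : E -> R :=
  'd (f \o chart_param (chart_at cX x)) (coord_at x).

Definition tangent_charts : charted (X * E) (E * E)%type :=
  {| chart_index := chart_index cX;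
     chart_dom i := [set z | chart_dom i z.1];
     chart_coord i z := (chart_coord i z.1, comp_of_vec i z.1 z.2);
     chart_param i y := (chart_param i y.1, vec_of_comp i y.1 y.2);
     chart_at z := chart_at cX z.1 |}.

(* T_x S for a submanifold S of X: velocities at 0 of smooth curves in S. *)
Definition tangent_space (S : set X) (x : X) : set E :=
  [set v | exists (g : R -> X) (e : R),
    [/\ 0 < e, g 0 = x,
        forall t, ball 0 e t -> S (g t) /\ chart_dom (chart_at cX x) (g t),
        smooth_on (ball 0 e) (chart_coord (chart_at cX x) \o g) &
        'D_1 (chart_coord (chart_at cX x) \o g) 0 = v]].

(* Smoothness of a vector field given on the submanifold S: its components
   extend locally to smooth functions on the ambient X. *)
Definition smooth_field_along (S : set X) (V : X -> E) : Prop :=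
  forall x, S x -> let i := chart_at cX x in
    exists (A : set E) (G : E -> E),
      [/\ open A, A (chart_coord i x), A `<=` chart_image i, smooth_on A G &
          forall x', S x' -> chart_dom i x' -> A (chart_coord i x') ->
            comp_of_vec i x' (V x') = G (chart_coord i x')].

Definition two_form (w : X -> E -> E -> R) : Prop :=
  [/\ forall x u, linear (w x u : E -> R^o),
      forall x v, linear (w x ^~ v : E -> R^o),
      forall x v, w x v v = 0 &
      forall i u v, smooth_on (chart_image i)
        (fun y => w (chart_param i y) (vec_of_comp i y u) (vec_of_comp i y v))].

End Calculus.

(* An open subset A of E, with the identity as single chart. *)
Definition open_charts {R : realType} {E : normedModType R} (A : set E) :
    charted E E :=
  {| chart_index := unit; chart_dom _ := A; chart_coord _ := id;
     chart_param _ := id; chart_at _ := tt |}.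

(* The topology of Q is the one for which the charts are homeomorphisms. *)
Record smooth_manifold {R : realType} (n : nat) (Q : topologicalType)
    (cQ : charted Q 'rV[R]_n) : Prop := SmoothManifold {
  manifold_hausdorff : hausdorff_space Q;
  manifold_second_countable : @second_countable Q;
  manifold_chart_at : forall q, chart_dom (chart_at cQ q) q;
  manifold_open_dom : forall i : chart_index cQ, open (chart_dom i);
  manifold_open_image : forall i : chart_index cQ, open (chart_image i);
  manifold_coordK : forall (i : chart_index cQ) q,
    chart_dom i q -> chart_param i (chart_coord i q) = q;
  manifold_coord_continuous : forall (i : chart_index cQ) q,
    chart_dom i q -> {for q, continuous (chart_coord i)};
  manifold_param_continuous : forall (i : chart_index cQ) y,
    chart_image i y -> {for y, continuous (chart_param i)};
  manifold_transition : forall i j : chart_index cQ,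
    smooth_on (chart_coord i @` (chart_dom i `&` chart_dom j))
              (chart_coord j \o chart_param i) }.

Section Nonholonomic.
Context {R : realType} {n k : nat} {Q : topologicalType}.
Notation E := 'rV[R]_n.
Notation TQ := (Q * 'rV[R]_n)%type.
(* A covector p at q is the row of its components in the selected chart at q. *)
Notation TstarQ := (Q * 'rV[R]_n)%type.
Variable cQ : charted Q E.

Definition pairing (p v : E) : R := \sum_(a < n) p 0 a * v 0 a.

Definition pullback_covector (f : E -> E) (p : E) : E :=
  \row_(a < n) pairing p (f (delta_mx 0 a)).

(* The canonical coordinates (q_a, p_a) induced by the charts of Q. *)
Definition cotangent_charts : charted TstarQ (E * E)%type :=
  {| chart_index := chart_index cQ;
     chart_dom i := [set m | chart_dom i m.1];
     chart_coord i m :=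
       (chart_coord i m.1,
        pullback_covector (vec_of_comp i (chart_coord i m.1)) m.2);
     chart_param i y :=
       (chart_param i y.1,
        pullback_covector (comp_of_vec i (chart_param i y.1)) y.2);
     chart_at m := chart_at cQ m.1 |}.

Definition bundle_proj (m : TstarQ) : Q := m.1.

Definition proj_tangent : TstarQ -> E * E -> E :=
  tangent_map cotangent_charts cQ bundle_proj.

(* dq_a /\ dp_a, in the canonical coordinates of the selected chart at m. *)
Definition canonical_form (m : TstarQ) (v w : E * E) : R :=
  pairing w.2 v.1 - pairing v.2 w.1.

Definition smooth_one_form (eps : Q -> E) : Prop :=
  smooth_map cQ cotangent_charts (fun q => (q, eps q)).

Definition independent_forms (eps : 'I_k -> Q -> E) : Prop :=
  forall q, row_free (\matrix_(i < k) eps i q).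

Definition annihilator (eps : 'I_k -> Q -> E) (q : Q) : set E :=
  [set v | forall i, pairing (eps i q) v = 0].

Definition distribution (eps : 'I_k -> Q -> E) : set TQ :=
  [set z | annihilator eps z.1 z.2].

(* Through every point passes an integral manifold, parametrized by an open
   subset of R^(n-k). *)
Definition integrable_distribution (eps : 'I_k -> Q -> E) : Prop :=
  forall q, exists (A : set 'rV[R]_(n - k)) (phi : 'rV[R]_(n - k) -> Q),
    [/\ open A, (phi @` A) q, smooth_map (open_charts A) cQ phi &
        forall y, A y ->
          range (tangent_map (open_charts A) cQ phi y)
          = annihilator eps (phi y)].

Definition legendre (L : TQ -> R) (z : TQ) : TstarQ :=
  (z.1, \row_(a < n) 'D_(delta_mx 0 a) (fun v : E => L (z.1, v)) z.2).

Definition energy (L : TQ -> R) (z : TQ) : R :=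
  pairing (legendre L z).2 z.2 - L z.

Definition diffeo_inverse (Leg : TQ -> TstarQ) (Leginv : TstarQ -> TQ) : Prop :=
  [/\ cancel Leg Leginv, cancel Leginv Leg,
      smooth_map (tangent_charts cQ) cotangent_charts Leg &
      smooth_map cotangent_charts (tangent_charts cQ) Leginv].

Definition fiber_linear (Leg : TQ -> TstarQ) : Prop :=
  forall q, linear (fun v : E => (Leg (q, v)).2).

Definition constraint_manifold (L : TQ -> R) (eps : 'I_k -> Q -> E) :
    set TstarQ :=
  legendre L @` distribution eps.

Definition lifted_distribution (eps : 'I_k -> Q -> E) (m : TstarQ) :
    set (E * E) :=
  [set v | forall i, pairing (eps i (bundle_proj m)) (proj_tangent m v) = 0].

Definition constraint_distribution (L : TQ -> R) (eps : 'I_k -> Q -> E)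
    (m : TstarQ) : set (E * E) :=
  tangent_space cotangent_charts (constraint_manifold L eps) m
  `&` lifted_distribution eps m.

Definition nondegenerate_on (W : set (E * E)) (w : E * E -> E * E -> R) : Prop :=
  forall u, W u -> (forall v, W v -> w u v = 0) -> u = 0.

Definition symplectic_complement (w : E * E -> E * E -> R) (W : set (E * E)) :
    set (E * E) :=
  [set v | forall u, W u -> w v u = 0].

Definition hamiltonian_field (H : TstarQ -> R) (XH : TstarQ -> E * E) : Prop :=
  forall m v, canonical_form m (XH m) v = dfun cotangent_charts H m v.

Definition nonholonomic_field (L : TQ -> R) (eps : 'I_k -> Q -> E)
    (H : TstarQ -> R) (Xnh : TstarQ -> E * E) : Prop :=
  let M := constraint_manifold L eps in
  [/\ forall m, M m -> constraint_distribution L eps m (Xnh m),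
      smooth_field_along cotangent_charts M Xnh &
      exists lambda : 'I_k -> TstarQ -> R,
        forall m v, M m -> tangent_space cotangent_charts M m v ->
          canonical_form m (Xnh m) v
          = dfun cotangent_charts H m v
            + \sum_(i < k) lambda i m
                * pairing (eps i (bundle_proj m)) (proj_tangent m v)].

Definition semi_basic (w : TstarQ -> E * E -> E * E -> R) : Prop :=
  forall m v, proj_tangent m v = 0 -> forall u, w m v u = 0.

(* Omega0 is such that Omega_Q + Omega0 is an affine almost symplectic
   structure; XH is the free Hamiltonian vector field. *)
Definition affine_almost_symplectic (XH : TstarQ -> E * E)
    (Omega0 : TstarQ -> E * E -> E * E -> R) : Prop :=
  [/\ two_form cotangent_charts Omega0,
      exists m u v, Omega0 m u v != 0,
      forall m v, Omega0 m (XH m) v = 0 &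
      semi_basic Omega0].

Definition affine_form (Omega0 : TstarQ -> E * E -> E * E -> R)
    (m : TstarQ) (u v : E * E) : R :=
  canonical_form m u v + Omega0 m u v.

End Nonholonomic.

(* Main.v *)
Require Import Defs.
From HB Require Import structures.
From mathcomp Require Import all_boot all_order all_algebra.
From mathcomp Require Import all_classical all_reals all_analysis.

Set Implicit Arguments.
Unset Strict Implicit.
Unset Printing Implicit Defensive.

Import Order.TTheory GRing.Theory Num.Theory.
Import numFieldNormedType.Exports.
Local Open Scope classical_set_scope.
Local Open Scope ring_scope.

(** A semi-basic form Omega0 sees only the horizontal part v.1 of a tangent
    vector v (and is skew), so it vanishes as soon as one of its two arguments
    is vertical. Testing a condition on Omega_Q + Omega0 against vertical
    vectors (0, p) is therefore the same as testing it on Omega_Q, and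
    Omega_Q(u, (0, p)) = <p, u.1>. Every part of the theorem follows the same
    pattern: enough vertical test vectors force a horizontal part to be zero,
    after which Omega0 drops out and Omega_Q alone decides.

    - On the whole tangent space, and on F, which contains all vertical
      vectors, this is immediate.

    - In C, the available vertical vectors at a point over q are the (0, Leg d)
      with d in D_q, because Leg is linear on fibres and so M meets the fibre in
      the linear space Leg(D_q) ([vertical_tangent]). What is needed is that an
      e in D_q with <Leg d, e> = 0 for all d in D_q is zero. Nondegeneracy of
      Omega_Q on C says that the form <Leg d, e> on D_q has no radical in its
      first argument, since (0, Leg d) pairs with w in C to - <Leg d, w.1>;
      in finite dimension the radical in the second argument is then zero too
      ([radical_right_eq0], [distribution_legendre_nondeg]).

    - For the nonholonomic field, X_nh and X_H have the same horizontal part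
      on M: both equal the velocity Leg^-1(m). For X_H this is the Legendre
      duality dH/dp = Leg^-1 ([dfun_hamiltonian_vertical]); it shows that
      X_H.1 lies in D on M. The constraint forces kill vertical vectors, so
      X_nh - X_H, whose horizontal part lies in D, is Omega_Q-orthogonal to all
      (0, Leg d), and its horizontal part vanishes. Hence
      i_(X_nh) Omega0 = i_(X_H) Omega0 = 0.

    The selected chart at q identifies tangent vectors and covectors at q with
    their components; most of the work on charts is to check that, at q and in
    that chart, the coordinate changes of the bundles TQ and T*Q are the
    identity, so that fibrewise computations can be made on vectors. *)

(** * Differentials *)

Section Differential.
Context {R : realType}.
Implicit Types U V W : normedModType R.

(** The differential is determined by the first-order expansion at x, which f
    and g share. *)
Lemma diff_near V W (f g : V -> W) (x : V) :
  (\near x, f x = g x) -> differentiable f x -> 'd g x = 'd f x :> (V -> W).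
Proof.
move=> fg df; have fgx := nbhs_singleton fg.
apply: diff_unique; first exact: diff_continuous.
apply/eqaddoP => _/posnumP[e].
have /eqaddoP/(_ e%:num) := diff_locally df => /(_ [elaborate gt0 e]) fo.
have fg0 : \forall h \near (0 : V), f (h + x) = g (h + x).
  by have := fg; rewrite (near_shift 0) subr0.
near=> h.
have -> : (g \o shift x - (cst (g x) + 'd f x)) h
    = (f \o shift x - (cst (f x) + 'd f x)) h.
  by rewrite !fctE /= fgx (near fg0 h).
by near: h.
Unshelve. all: by end_near. Qed.

Lemma diff_near_id V (f : V -> V) (x v : V) :
  (\near x, f x = x) -> 'd f x v = v.
Proof.
move=> fid; rewrite (@diff_near _ _ id) ?diff_val //.
by near do apply/esym.
Unshelve. all: by end_near. Qed.

Lemma is_diff_fst V W (p : V * W) : is_diff p fst fst.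
Proof.
have c : continuous (@fst V W) by move=> ?; apply: cvg_fst.
by apply: DiffDef; [exact: linear_differentiable|exact: diff_lin].
Qed.

Lemma is_diff_snd V W (p : V * W) : is_diff p snd snd.
Proof.
have c : continuous (@snd V W) by move=> ?; apply: cvg_snd.
by apply: DiffDef; [exact: linear_differentiable|exact: diff_lin].
Qed.

Lemma is_diff_affine V (a b : V) (x : R) :
  is_diff x (fun t : R => a + t *: b) (fun t : R => t *: b).
Proof.
apply: is_diff_eq (is_diffD (is_diff_cst a x) (is_diff_scalel x b)) _.
by apply/funext => t; rewrite fctE add0r.
Qed.

Lemma smooth_on_affine V (A : set R) (a b : V) :
  smooth_on A (fun t : R => a + t *: b).
Proof.
move=> s x _.
(* Affine functions are stable under directional derivatives. *)
suff [c [d ->]] : exists c d : V,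
    foldr (fun v (g : R -> V) => 'D_v g) (fun t : R => a + t *: b) s
    = (fun t => c + t *: d) by have [] := is_diff_affine c d x.
elim: s => [|v s [c [d /= ->]]]; first by exists a, b.
exists (v *: d), 0; apply/funext => t; rewrite scaler0 addr0.
have cd := is_diff_affine c d t.
by rewrite deriveE ?diff_val //; apply: ex_diff.
Qed.

End Differential.

(** * The pairing of covectors and vectors *)

Section Pairing.
Context {R : realType} {n : nat}.
Implicit Types p v w : 'rV[R]_n.

Lemma pairingE p v : pairing p v = (p *m v^T) 0 0.
Proof. by rewrite mxE; apply: eq_bigr => a _; rewrite mxE. Qed.

Lemma pairing_is_bilinear :
  bilinear_for
    (GRing.Scale.Law.clone _ _ *:%R _) (GRing.Scale.Law.clone _ _ *:%R _)
    (@pairing R n).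
Proof.
split=> [v|p] a x y /=; rewrite /pairing /GRing.scale/= mulr_sumr -big_split;
  apply: eq_bigr => i _ /=;
  by rewrite !mxE ?mulrDl ?mulrDr ?mulrA // [_ * a]mulrC.
Qed.

(* Gives access to the differential calculus of bilinear maps. *)
HB.instance Definition _ := bilinear_isBilinear.Build R
  'rV[R]_n 'rV[R]_n R _ _ (@pairing R n) pairing_is_bilinear.

Lemma pairing_deltar p a : pairing p (delta_mx 0 a) = p 0 a.
Proof. by rewrite pairingE trmx_delta -colE mxE. Qed.

Lemma pairing_inj_l p : (forall v, pairing p v = 0) -> p = 0.
Proof. by move=> p0; apply/rowP => a; rewrite -pairing_deltar p0 mxE. Qed.

Lemma pairingC p v : pairing p v = pairing v p.
Proof. by apply: eq_bigr => a _; rewrite mulrC. Qed.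

(** [pullback_covector] samples f on the basis vectors, which determine a linear
    f. *)
Lemma pairing_pullback (f : {linear 'rV[R]_n -> 'rV[R]_n}) p v :
  pairing (pullback_covector f p) v = pairing p (f v).
Proof.
rewrite [in RHS](row_sum_delta v) linear_sum linear_sumr.
by apply: eq_bigr => a _; rewrite mxE linearZ linearZr /= mulrC.
Qed.

Lemma pairingDZr p a v w :
  pairing p (v + a *: w) = pairing p v + a * pairing p w.
Proof. by rewrite linearDr linearZr_LR. Qed.

Lemma pairingBr p v w : pairing p (v - w) = pairing p v - pairing p w.
Proof. exact: linearBr. Qed.

Lemma pairing0r p : pairing p 0 = 0.
Proof. exact: linear0r. Qed.

Lemma pairing0l v : pairing 0 v = 0.
Proof. by rewrite pairingC pairing0r. Qed.

Lemma continuous_pairing :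
  continuous (fun q : 'rV[R]_n * 'rV[R]_n => pairing q.1 q.2).
Proof.
move=> q; apply: differentiable_continuous.
rewrite (_ : (fun _ => _) = \sum_(a < n)
  ((fun q : 'rV[R]_n * 'rV[R]_n => q.1 0 a) * (fun q => q.2 0 a))); last first.
  by apply/funext => x; rewrite fct_sumE.
apply: differentiable_sum => a; apply: differentiableM.
  exact: (differentiable_comp (@ex_diff _ _ _ _ _ _ _ (is_diff_fst q))
    (differentiable_coord _ 0 a)).
exact: (differentiable_comp (@ex_diff _ _ _ _ _ _ _ (is_diff_snd q))
  (differentiable_coord _ 0 a)).
Qed.

Lemma is_diff_pairing {V : normedModType R} (f df g dg : V -> 'rV[R]_n) (x : V) :
  is_diff x f df -> is_diff x g dg ->
  is_diff x (fun y => pairing (f y) (g y))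
    (fun h => pairing (f x) (dg h) + pairing (df h) (g x)).
Proof.
move=> dfx dgx.
have pair_diff (q : 'rV[R]_n * 'rV[R]_n) : is_diff q (fun q => pairing q.1 q.2)
    (fun h => pairing q.1 h.2 + pairing h.1 q.2).
  apply: DiffDef; last by rewrite diff_bilin //; exact: continuous_pairing.
  by apply: differentiable_bilin; exact: continuous_pairing.
rewrite (_ : (fun y => _) = (fun q => pairing q.1 q.2) \o (fun y => (f y, g y)))//.
exact: is_diff_eq.
Qed.

(** The Legendre duality dH/dp = velocity, in coordinates. Here F stands for
    the inverse Legendre transform (q, p) |-> (q, v(q, p)), l for the
    Lagrangian, and h = <p, v> - l(q, v) for the Hamiltonian. When p moves in
    the direction w and v accordingly moves by d, the terms <p, d> and
    dl/dv (d) cancel because p = dl/dv, and <w, v> is left. *)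
Lemma diff_fiber_legendre (F : 'rV[R]_n * 'rV[R]_n -> 'rV[R]_n * 'rV[R]_n)
    (l h : 'rV[R]_n * 'rV[R]_n -> R) (y : 'rV[R]_n * 'rV[R]_n) :
  (\forall y' \near y, (F y').1 = y'.1) ->
  (\forall y' \near y, h y' = pairing y'.2 (F y').2 - l (F y')) ->
  differentiable F y -> differentiable l (F y) ->
  (forall d, 'd l (F y) (0, d) = pairing y.2 d) ->
  forall w, 'd h y (0, w) = pairing w (F y).2.
Proof.
move=> F1 hE dF dl dlE w.
have isF : is_diff y F ('d F y) by apply: DiffDef.
have isl : is_diff (F y) l ('d l (F y)) by apply: DiffDef.
have isF1 := is_diff_comp isF (is_diff_fst (F y)).
have isF2 := is_diff_comp isF (is_diff_snd (F y)).
(* F preserves the base point, so that a vertical w has a vertical image. *)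
have dF1 : ('d F y (0, w)).1 = 0.
  rewrite -[LHS]/((fst \o 'd F y) (0, w)) -(@diff_val _ _ _ _ _ _ _ isF1).
  rewrite (@diff_near _ _ _ fst).
  - by rewrite (@diff_val _ _ _ _ _ _ _ (is_diff_fst y)).
  - by apply: filterS F1 => y' /= ->.
  - exact: (@ex_diff _ _ _ _ _ _ _ (is_diff_fst y)).
have isl_F := is_diff_comp isF isl.
pose k y' := pairing y'.2 (F y').2 - (l \o F) y'.
have isk := is_diffB (is_diff_pairing (is_diff_snd y) isF2) isl_F.
rewrite (@diff_near _ _ _ k); last 2 first.
- by apply: filterS hE => y' ->.
- exact: (@ex_diff _ _ _ _ _ _ _ isk).
rewrite (@diff_val _ _ _ _ _ _ _ isk) !fctE /=.
rewrite [X in 'd l _ X]surjective_pairing dF1 dlE.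
by rewrite addrAC subrr add0r.
Qed.

(** On a finite-dimensional space (here the kernel of A) a bilinear form
    (d, e) |-> <d G, e> whose radical is zero on the first argument has zero
    radical on the second one: its Gram matrix S in a basis B is square, so S
    is invertible as soon as its rows are free. *)
Lemma radical_right_eq0 m (A : 'M[R]_(n, m)) (G : 'M[R]_n) :
  (forall d, d *m A = 0 -> (forall e, e *m A = 0 -> pairing (d *m G) e = 0) ->
    d = 0) ->
  forall e, e *m A = 0 -> (forall d, d *m A = 0 -> pairing (d *m G) e = 0) ->
  e = 0.
Proof.
move=> nondeg e eA eG.
pose B := row_base (kermx A).
have kerP (d : 'rV[R]_n) : d *m A = 0 <-> (d <= B)%MS.
  by rewrite eq_row_base; split=> [/sub_kermxP|/sub_kermxP].
have BA (y : 'rV_(\rank (kermx A))) : y *m B *m A = 0.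
  rewrite -mulmxA (_ : B *m A = 0) ?mulmx0 //.
  by apply/sub_kermxP; rewrite eq_row_base.
pose S := B *m G *m B^T.
have S_unit : S \in unitmx.
  rewrite -row_free_unit -kermx_eq0; apply/eqP/row_matrixP => i; rewrite row0.
  set y := row i _.
  have yS : y *m S = 0 by rewrite /y -row_mul mulmx_ker row0.
  suff yB : y *m B = 0.
    by apply: (row_free_inj (row_base_free (kermx A))); rewrite yB mul0mx.
  apply: nondeg => [|w /kerP /submxP[z ->]]; first exact: BA.
  have -> : pairing (y *m B *m G) (z *m B) = (y *m S *m z^T) 0 0.
    by rewrite pairingE trmx_mul /S !mulmxA.
  by rewrite yS mul0mx mxE.
have /kerP/submxP[z ez] := eA.
suff z0 : S *m z^T = 0.
  by rewrite ez -[z]trmxK -[z^T](mulKmx S_unit) z0 mulmx0 trmx0 mul0mx.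
apply/row_matrixP => i; rewrite row0; apply/rowP => j.
rewrite ord1 [RHS]mxE rowE -(eG (delta_mx 0 i *m B)) ?BA //.
by rewrite ez pairingE trmx_mul /S !mulmxA.
Qed.

End Pairing.

(** * Charts of the base, of TQ and of T*Q *)

Section Charts.
Context {R : realType} {n : nat} {Q : topologicalType}.
Variables (cQ : charted Q 'rV[R]_n) (hQ : smooth_manifold cQ).
Notation E := 'rV[R]_n.
Implicit Types (q : Q) (m : Q * E).

Lemma coord_in_image (i : chart_index cQ) q :
  chart_dom i q -> chart_image i (chart_coord i q).
Proof. by exists q. Qed.

Lemma chart_paramK (i : chart_index cQ) (y : E) : chart_image i y ->
  chart_dom i (chart_param i y) /\ chart_coord i (chart_param i y) = y.
Proof. by move=> [q qi <-]; rewrite (manifold_coordK hQ). Qed.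

Lemma near_chart_image (i : chart_index cQ) q : chart_dom i q ->
  \forall y \near chart_coord i q, chart_image i y.
Proof.
move=> qi; apply: open_nbhs_nbhs; split; last exact: coord_in_image.
exact: manifold_open_image.
Qed.

Lemma near_chart_paramK (i : chart_index cQ) q : chart_dom i q ->
  \forall y \near chart_coord i q, chart_coord i (chart_param i y) = y.
Proof. by move/near_chart_image; apply: filterS => y /chart_paramK[]. Qed.

Lemma near_param_dom (i j : chart_index cQ) q : chart_dom i q ->
  chart_dom j q -> \forall y \near chart_coord i q, chart_dom j (chart_param i y).
Proof.
move=> qi qj.
have := @manifold_param_continuous _ _ _ _ hQ _ _ (coord_in_image qi).
rewrite /prop_for /continuous_at (manifold_coordK hQ qi); apply.
by apply: open_nbhs_nbhs; split => //; apply: manifold_open_dom.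
Qed.

(** The components of v in the selected chart are v itself: the derivative
    involved is that of coord_i o param_i, which is the identity near coord q.
    Likewise for [vec_of_comp_at]. *)
Lemma comp_of_vec_at q v : comp_of_vec (chart_at cQ q) q v = v.
Proof.
exact/diff_near_id/near_chart_paramK/(manifold_chart_at hQ).
Qed.

Lemma vec_of_comp_at q v : vec_of_comp (chart_at cQ q) (coord_at cQ q) v = v.
Proof.
have qi := manifold_chart_at hQ q.
rewrite /vec_of_comp /coord_at (manifold_coordK hQ qi).
exact/diff_near_id/near_chart_paramK.
Qed.

(** Chain rule for the two mutually inverse coordinate changes between chart i
    and the selected chart at q. *)
Lemma comp_of_vecK (i : chart_index cQ) q v : chart_dom i q ->
  vec_of_comp i (chart_coord i q) (comp_of_vec i q v) = v.
Proof.
move=> qi; rewrite /vec_of_comp /comp_of_vec (manifold_coordK hQ qi) /coord_at.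
set j := chart_at cQ q; have qj : chart_dom j q := manifold_chart_at hQ q.
have ji : differentiable (chart_coord i \o chart_param j) (chart_coord j q).
  by apply: (@manifold_transition _ _ _ _ hQ j i [::]); exists q.
have ij : differentiable (chart_coord j \o chart_param i)
    ((chart_coord i \o chart_param j) (chart_coord j q)).
  apply: (@manifold_transition _ _ _ _ hQ i j [::]) => /=.
  by rewrite (manifold_coordK hQ qj); exists q.
have := congr1 (fun f => f v) (diff_comp ji ij).
rewrite /= (manifold_coordK hQ qj) => <-; apply: diff_near_id.
near=> y => /=.
have yj : chart_image j y by near: y; apply: near_chart_image.
have yi : chart_dom i (chart_param j y) by near: y; apply: near_param_dom.
by rewrite (manifold_coordK hQ yi); have [] := chart_paramK yj.
Unshelve. all: by end_near. Qed.

Lemma cotangent_coord_at m :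
  coord_at (cotangent_charts cQ) m = (coord_at cQ m.1, m.2).
Proof.
rewrite [LHS]/coord_at /=; congr pair; apply/rowP => a.
rewrite mxE -/(coord_at cQ m.1) vec_of_comp_at; exact: pairing_deltar.
Qed.

Lemma cotangent_param_fiber q p :
  chart_param (c := cotangent_charts cQ) (chart_at cQ q) (coord_at cQ q, p) = (q, p).
Proof.
have qi := manifold_chart_at hQ q.
rewrite /= /coord_at (manifold_coordK hQ qi); congr pair; apply/rowP => a.
by rewrite mxE comp_of_vec_at; apply: pairing_deltar.
Qed.

Lemma tangent_param_fiber q v :
  chart_param (c := tangent_charts cQ) (chart_at cQ q) (coord_at cQ q, v) = (q, v).
Proof.
by rewrite /= vec_of_comp_at /coord_at (manifold_coordK hQ (manifold_chart_at hQ q)).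
Qed.

Lemma tangent_coord_fiber q v :
  chart_coord (c := tangent_charts cQ) (chart_at cQ q) (q, v)
  = (coord_at cQ q, v).
Proof. by rewrite /= comp_of_vec_at. Qed.

Lemma tangent_coordK (i : chart_index cQ) (z : Q * E) : chart_dom i z.1 ->
  chart_param (c := tangent_charts cQ) i (chart_coord (c := tangent_charts cQ) i z)
  = z.
Proof.
case: z => q v /= qi.
by rewrite comp_of_vecK // (manifold_coordK hQ qi).
Qed.

Lemma proj_tangentE m v : proj_tangent cQ m v = v.1.
Proof.
rewrite /proj_tangent /tangent_map cotangent_coord_at.
have nE : \forall y \near (coord_at cQ m.1, m.2),
    chart_coord (chart_at cQ m.1) (chart_param (chart_at cQ m.1) y.1) = y.1.
  have qi := manifold_chart_at hQ m.1.
  exact: (@cvg_fst _ _ _ (nbhs m.2) _ _ (near_chart_paramK qi)).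
have dfst := is_diff_fst (coord_at cQ m.1, m.2).
rewrite (@diff_near _ _ _ fst) ?(@diff_val _ _ _ _ _ _ _ dfst) //.
by apply: filterS nE => y /= ->.
Qed.

(** * The Legendre transform *)

Section Legendre.
Variables (L : Q * E -> R) (hL : smooth_fun (tangent_charts cQ) L).

(* The Lagrangian in the selected chart at q. *)
Let Lloc q := L \o chart_param (c := tangent_charts cQ) (chart_at cQ q).

Lemma differentiable_lagrangian q v :
  differentiable (Lloc q) (coord_at cQ q, v).
Proof.
apply: (@hL (chart_at cQ q) [::]); rewrite -tangent_coord_fiber; exists (q, v) => //=.
exact: manifold_chart_at.
Qed.

(** [legendre] only collects partial derivatives; smoothness of L makes them the
    components of a differential, that of L along the fibre. *)
Lemma diff_lagrangian_fiber q v w :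
  'd (Lloc q) (coord_at cQ q, v) (0, w) = pairing (legendre L (q, v)).2 w.
Proof.
have dL := differentiable_lagrangian q v.
pose l v := L (q, v).
have lE : l = Lloc q \o (fun v => (coord_at cQ q, v)).
  by apply/funext => u; rewrite /Lloc [RHS]/= -[LHS]/(L _) -tangent_param_fiber.
have dl : is_diff v l ('d (Lloc q) (coord_at cQ q, v) \o (fun w => (0, w))).
  have dpair := is_diff_pair (is_diff_cst (coord_at cQ q) v) (is_diff_id v).
  by rewrite lE; apply: is_diff_comp; apply: DiffDef.
have -> : 'd (Lloc q) (coord_at cQ q, v) (0, w) = 'd l v w by rewrite diff_val.
rewrite [in LHS](row_sum_delta w) linear_sum; apply: eq_bigr => a _.
by rewrite mxE linearZ /= mulrC -deriveE //; apply: ex_diff.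
Qed.

Variables (Leginv : Q * E -> Q * E).
Hypothesis hLeg : diffeo_inverse cQ (legendre L) Leginv.

Lemma legendre_inv_base m : (Leginv m).1 = m.1.
Proof. by have [_ K _ _] := hLeg; rewrite -[in RHS](K m). Qed.

Lemma energy_legendre_inv m :
  energy L (Leginv m) = pairing m.2 (Leginv m).2 - L (Leginv m).
Proof. by have [_ K _ _] := hLeg; rewrite /energy K. Qed.

(** This is dH/dp = Leg^-1(m). Since [dfun] is a derivative of H in the canonical
    coordinates of the selected chart, H has to be differentiable there: in
    these coordinates it is <p, v> - L(q, v) with v the components of
    Leg^-1(q, p), which are smooth because Leg^-1 is a smooth map of
    manifolds. *)
Lemma dfun_hamiltonian_vertical m w :
  dfun (cotangent_charts cQ) (energy L \o Leginv) m (0, w)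
  = pairing w (Leginv m).2.
Proof.
have [_ LegK _ /(_ (chart_at cQ m.1) (chart_at cQ m.1))] := hLeg.
(* F is Leginv in charts, A the open set on which it is smooth. *)
move=> /=; set i := chart_at cQ m.1; set A := _ @` _; set F := _ \o _.
move=> [Aopen /(_ [::]) /= Fdiff].
have mi : chart_dom i m.1 := manifold_chart_at hQ m.1.
rewrite /dfun cotangent_coord_at /=; set y0 := (_, m.2).
have Ay0 : A y0.
  rewrite /y0 -cotangent_coord_at; exists m => //=; split => //=.
  by rewrite legendre_inv_base.
have nA : \forall y \near y0, A y by apply: open_nbhs_nbhs.
have Fy0 : F y0 = (coord_at cQ m.1, (Leginv m).2).
  rewrite /F /= -[X in Leginv X]/(chart_param (c := cotangent_charts cQ) i y0).
  rewrite cotangent_param_fiber -surjective_pairing.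
  by rewrite legendre_inv_base comp_of_vec_at.
pose h := energy L \o Leginv \o chart_param (c := cotangent_charts cQ) i.
have hE y : A y -> h y = pairing y.2 (F y).2 - Lloc m.1 (F y) /\ (F y).1 = y.1.
  move=> [m' [m'i _] ym']; have {}m'i : chart_dom i m'.1 := m'i.
  have y1 : chart_param i y.1 = m'.1 by rewrite -ym' /= (manifold_coordK hQ m'i).
  have {}ym' : y.1 = chart_coord i m'.1 by rewrite -ym'.
  set m'' := chart_param (c := cotangent_charts cQ) i y.
  have z1 : (Leginv m'').1 = m'.1 by rewrite legendre_inv_base.
  have Fy : F y = chart_coord (c := tangent_charts cQ) i (Leginv m'') by [].
  have F2 : (F y).2 = comp_of_vec i m'.1 (Leginv m'').2 by rewrite Fy /= z1.
  have zi : chart_dom i (Leginv m'').1 by rewrite z1.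
  have -> : Lloc m.1 (F y) = L (Leginv m'').
    by rewrite Fy; exact: (congr1 L (tangent_coordK zi)).
  have -> : h y = pairing m''.2 (Leginv m'').2 - L (Leginv m'').
    exact: energy_legendre_inv.
  split; last by rewrite Fy ym' /= z1.
  by congr (_ - _); rewrite F2 /m'' /= pairing_pullback y1.
rewrite (@diff_fiber_legendre _ _ F (Lloc m.1) h y0) ?Fy0 //.
- by apply: filterS nA => y /hE[].
- by apply: filterS nA => y /hE[].
- exact: Fdiff.
- exact: differentiable_lagrangian.
- move=> d; rewrite diff_lagrangian_fiber -(legendre_inv_base m).
  by rewrite -surjective_pairing LegK.
Qed.

Hypothesis hLeg_lin : fiber_linear (legendre L).

(** Leg d is tangent at m = Leg z to the line t |-> Leg (z + t d), which stays in
    the fibre of M since D_q and Leg are linear. *)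
Lemma vertical_tangent k (eps : 'I_k -> Q -> E) m d :
  constraint_manifold L eps m -> annihilator eps m.1 d ->
  tangent_space (cotangent_charts cQ) (constraint_manifold L eps) m
    (0, (legendre L (m.1, d)).2).
Proof.
move=> [z zD <-] dD; rewrite /= -/(legendre L z).
set G := fun v : E => (legendre L (z.1, v)).2.
pose g (t : R) : Q * E := (z.1, G z.2 + t *: G d).
have gE : chart_coord (c := cotangent_charts cQ) (chart_at cQ z.1) \o g
    = (fun t => (coord_at cQ z.1, G z.2) + t *: (0, G d)).
  apply/funext => t; rewrite /comp -[LHS]/(coord_at (cotangent_charts cQ) (g t)).
  by rewrite cotangent_coord_at; congr pair; rewrite /= ?scaler0 ?addr0.
exists g, 1; split => //.
- by rewrite /g scale0r addr0 /G -surjective_pairing.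
- move=> t _; split; last exact: manifold_chart_at.
  exists (z.1, z.2 + t *: d).
    move=> i; have zi := zD i; have di := dD i; rewrite /= in zi di *.
    by rewrite pairingDZr [X in X + _]zi [X in _ * X]di mulr0 addr0.
  have Gt : G (z.2 + t *: d) = G z.2 + t *: G d.
    by rewrite addrC [RHS]addrC; exact: (hLeg_lin z.1 t d z.2).
  by congr pair; exact: Gt.
- rewrite gE; exact: smooth_on_affine.
- rewrite gE; have ds := is_diff_affine (coord_at cQ z.1, G z.2) (0, G d) 0.
  by rewrite deriveE ?diff_val ?scale1r //; exact: ex_diff.
Qed.

(** If d in D is such that Leg d annihilates D, then (0, Leg d) lies in C and is
    in the radical of Omega_Q on C, so Leg d = 0 and d = 0. By
    [radical_right_eq0] the roles of d and e can be exchanged. *)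
Lemma distribution_legendre_nondeg k (eps : 'I_k -> Q -> E) m :
  constraint_manifold L eps m ->
  nondegenerate_on (constraint_distribution cQ L eps m) (canonical_form m) ->
  forall e, annihilator eps m.1 e ->
    (forall d, annihilator eps m.1 d -> pairing (legendre L (m.1, d)).2 e = 0) ->
  e = 0.
Proof.
move=> mM nondeg.
pose A := (\matrix_(i < k) eps i m.1)^T.
have AP d : annihilator eps m.1 d <-> d *m A = 0.
  split=> [dD|dA i].
    apply/rowP => i; have := dD i; rewrite pairingC pairingE mxE => di.
    by rewrite [RHS]mxE -[RHS]di mxE; apply: eq_bigr => a _; rewrite !mxE.
  have := congr1 (fun M : 'rV_k => M 0 i) dA.
  rewrite pairingC pairingE !mxE => di.
  by rewrite -[RHS]di; apply: eq_bigr => a _; rewrite !mxE.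
pose lin := GRing.isLinear.Build _ _ _ _ _ (hLeg_lin m.1).
pose G : {linear E -> E} := HB.pack (fun v : E => (legendre L (m.1, v)).2) lin.
have GE d : d *m lin1_mx G = (legendre L (m.1, d)).2 by rewrite mul_rV_lin1.
have sym := @radical_right_eq0 R n k A (lin1_mx G).
move=> e /AP eA eG; apply: sym eA _ => [d dA dG|d /AP dD]; last first.
  by rewrite GE; exact: eG.
have /AP dD := dA.
have Gd0 : (0, (legendre L (m.1, d)).2) = 0 :> E * E.
  apply: nondeg => [|v [_ vF]].
    split; first exact: vertical_tangent.
    by move=> i; rewrite proj_tangentE pairing0r.
  rewrite /canonical_form pairing0r sub0r -GE dG ?oppr0 //.
  by apply/AP => i; rewrite -(proj_tangentE m); exact: vF.
have [LegK _ _ _] := hLeg.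
have Leg_inj := can_inj LegK.
have Gd2 : (legendre L (m.1, d)).2 = 0 := congr1 snd Gd0.
have Leg0 : (legendre L (m.1, 0)).2 = 0 by rewrite -GE mul0mx.
suff /Leg_inj[] : legendre L (m.1, d) = legendre L (m.1, 0) by [].
by rewrite [LHS]surjective_pairing [RHS]surjective_pairing Leg0 Gd2.
Qed.

End Legendre.

Lemma semi_basic_congr (w : Q * E -> E * E -> E * E -> R) m u u' v :
  (forall m v, linear (w m ^~ v : E * E -> R^o)) -> semi_basic cQ w ->
  u.1 = u'.1 -> w m u v = w m u' v.
Proof.
move=> lin sb uu.
rewrite -[u in LHS](subrK u') -[u - u']scale1r lin sb ?scaler0 ?add0r //.
by rewrite proj_tangentE /= uu subrr.
Qed.

End Charts.

(** * Affine almost symplectic structures *)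

Lemma two_form_skew (R : realType) (X : Type) (E : normedModType R)
    (cX : charted X E) (w : X -> E -> E -> R) x u v :
  two_form cX w -> w x u v = - w x v u.
Proof.
move=> [linr linl alt _].
have addl a b c : w x (a + b) c = w x a c + w x b c.
  by have := linl x c 1 a b; rewrite !scale1r.
have addr a b c : w x a (b + c) = w x a b + w x a c.
  by have := linr x a 1 b c; rewrite !scale1r.
have := alt x (u + v); rewrite addl !addr !alt add0r addr0.
by move/eqP; rewrite addr_eq0 => /eqP.
Qed.

Theorem theorem4p1 (R : realType) (n k : nat) (hkn : (k < n)%N)
  (Q : topologicalType) (cQ : charted Q 'rV[R]_n) (hQ : smooth_manifold cQ)
  (eps : 'I_k -> Q -> 'rV[R]_n)
  (heps_smooth : forall i, smooth_one_form cQ (eps i))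
  (heps_indep : independent_forms eps)
  (hD : ~ integrable_distribution cQ eps)
  (L : Q * 'rV[R]_n -> R) (hL : smooth_fun (tangent_charts cQ) L)
  (Leginv : Q * 'rV[R]_n -> Q * 'rV[R]_n)
  (hLeg : diffeo_inverse cQ (legendre L) Leginv)
  (hLeg_lin : fiber_linear (legendre L))
  (H : Q * 'rV[R]_n -> R) (hH : H = energy L \o Leginv)
  (hC : forall m, constraint_manifold L eps m ->
     nondegenerate_on (constraint_distribution cQ L eps m) (canonical_form m))
  (XH : Q * 'rV[R]_n -> 'rV[R]_n * 'rV[R]_n)
  (hXH : hamiltonian_field cQ H XH)
  (Xnh : Q * 'rV[R]_n -> 'rV[R]_n * 'rV[R]_n)
  (hXnh : nonholonomic_field cQ L eps H Xnh)
  (Omega0 : Q * 'rV[R]_n ->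
     'rV[R]_n * 'rV[R]_n -> 'rV[R]_n * 'rV[R]_n -> R)
  (hOmega0 : affine_almost_symplectic cQ XH Omega0) :
  [/\ forall m, nondegenerate_on setT (affine_form Omega0 m),
      forall m, constraint_manifold L eps m ->
        nondegenerate_on (constraint_distribution cQ L eps m)
          (affine_form Omega0 m),
      forall m v, constraint_manifold L eps m ->
        tangent_space (cotangent_charts cQ) (constraint_manifold L eps) m v ->
        canonical_form m (Xnh m) v = affine_form Omega0 m (Xnh m) v &
      forall m,
        symplectic_complement (canonical_form m)
          (lifted_distribution cQ eps m)
        = symplectic_complement (affine_form Omega0 m)
          (lifted_distribution cQ eps m)].
Proof.
have [form _ XH0 sb] := hOmega0.
have vert (m : Q * 'rV[R]_n) u v : u.1 = 0 -> Omega0 m u v = 0.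
  by move=> u1; apply: sb; rewrite (proj_tangentE hQ).
have vert_r (m : Q * 'rV[R]_n) u v : v.1 = 0 -> Omega0 m u v = 0.
  by move=> v1; rewrite (two_form_skew _ _ _ form) vert ?oppr0.
have can_vert (m : Q * 'rV[R]_n) u p : canonical_form m u (0, p)
    = pairing p u.1.
  by rewrite /canonical_form /= pairing0r subr0.
have aff_vert (m : Q * 'rV[R]_n) u p :
    affine_form Omega0 m u (0, p) = pairing p u.1.
  by rewrite /affine_form can_vert vert_r // addr0.
have aff_can (m : Q * 'rV[R]_n) u v : u.1 = 0 ->
    affine_form Omega0 m u v = canonical_form m u v.
  by move=> u1; rewrite /affine_form vert // addr0.
have pairing0 u : (forall p, pairing p u = 0) -> u = 0 :> 'rV[R]_n.
  by move=> u0; apply: pairing_inj_l => p; rewrite pairingC.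
have vertC m d : constraint_manifold L eps m -> annihilator eps m.1 d ->
    constraint_distribution cQ L eps m (0, (legendre L (m.1, d)).2).
  move=> mM dD; split; first exact: vertical_tangent.
  by move=> i; rewrite (proj_tangentE hQ) pairing0r.
have nondegD m mM :=
  distribution_legendre_nondeg hQ hLeg hLeg_lin mM (hC m mM).
split.
- move=> m u _ u0.
  have u1 : u.1 = 0 by apply: pairing0 => p; rewrite -(aff_vert m) u0.
  have u2 : u.2 = 0.
    apply: pairing_inj_l => v; have := u0 (v, 0) I.
    rewrite aff_can // /canonical_form /= pairing0l sub0r.
    by move/eqP; rewrite oppr_eq0 => /eqP.
  by rewrite [u]surjective_pairing u1 u2.
- move=> m mM u uC u0.
  have u1 : u.1 = 0.
    apply: (nondegD m mM) => [i|d dD].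
      by have [_ /(_ i)] := uC; rewrite (proj_tangentE hQ).
    by rewrite -(aff_vert m) u0 //; exact: vertC.
  by apply: (hC m mM u uC) => v vC; rewrite -aff_can // u0.
- move=> m v mM _.
  have XH1 : (XH m).1 = (Leginv m).2.
    apply/subr0_eq/pairing0 => p; rewrite pairingBr -(can_vert m) hXH hH.
    by rewrite (dfun_hamiltonian_vertical hQ hL hLeg) subrr.
  have XHD : annihilator eps m.1 (XH m).1.
    by rewrite XH1; case: hLeg => LegK _ _ _; case: mM => z zD <-; rewrite LegK.
  have [XC _ [lambda XE]] := hXnh.
  have XD : annihilator eps m.1 (Xnh m).1.
    by move=> i; have [_ /(_ i)] := XC m mM; rewrite (proj_tangentE hQ).
  suff X1 : (Xnh m).1 = (XH m).1.
    have [_ lin _ _] := form.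
    by rewrite /affine_form (semi_basic_congr hQ m v lin sb X1) XH0 addr0.
  apply/subr0_eq/(nondegD m mM) => [i|d dD].
    by rewrite pairingBr [X in X - _]XD [X in _ - X]XHD subrr.
  rewrite pairingBr -!(can_vert m) hXH XE //; last by case: (vertC m d mM dD).
  (* The multiplier terms are semi-basic one-forms: they vanish on (0, Leg d). *)
  rewrite big1 ?addr0 ?subrr // => i _.
  by rewrite (proj_tangentE hQ) pairing0r mulr0.
- have vertF m p : lifted_distribution cQ eps m (0, p).
    by move=> i; rewrite (proj_tangentE hQ) pairing0r.
  move=> m; apply/seteqP; split=> v vF u uF.
    have v1 : v.1 = 0.
      by apply: pairing0 => p; rewrite -(can_vert m); exact: vF.
    by rewrite aff_can //; exact: vF.
  have v1 : v.1 = 0.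
    by apply: pairing0 => p; rewrite -(aff_vert m); exact: vF.
  by rewrite -aff_can //; exact: vF.
Qed.
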